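(* Let $p,q$ be positive integers, let $\mathcal{V}^q$ be the inner product space of random variables described in the context, and let $X_i=\bm a_i^\top\circ\bm Z\in\mathcal{V}^q$ with $\bm a_i\in\mathbb{R}^q$, for $i=1,\ldots,p+1$. Write $\bm X_p=(X_1,\ldots,X_p)^\top$ and $\bm b^\top\circ\bm X_p:=b_1\circ X_1\oplus\cdots\oplus b_p\circ X_p$ for $\bm b\in\mathbb{R}^p$. Let $A_p$ be the $p\times q$ matrix whose $i$th row is $\bm a_i^\top$, $i=1,\ldots,p$, and let $\Gamma_{11}=A_pA_p^\top=[\langle X_i,X_j\rangle]_{i,j=1}^p$ and $\Gamma_{12}=A_p\bm a_{p+1}=[\langle X_i,X_{p+1}\rangle]_{i=1}^p$. Any minimizer $\bm b^*\in\mathbb{R}^p$ of $\bm b\mapsto d(\bm b^\top\circ\bm X_p,\,X_{p+1})$ over $\bm b\in\mathbb{R}^p$ solves $$(A_pA_p^\top)\,\bm b^*=A_p\bm a_{p+1},$$ and if $A_pA_p^\top$ is invertible, then the minimizer is $$\bm b^*=(A_pA_p^\top)^{-1}A_p\bm a_{p+1}=\Gamma_{11}^{-1}\Gamma_{12}.$$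
   Context: Transformed-linear operations. Let $t(y)=\log\{1+\exp(y)\}$, a monotone bijection from $\mathbb{R}$ onto $(0,\infty)$, with inverse $t^{-1}(x)=\log\{\exp(x)-1\}$. For positive $x_1,x_2$ and $a\in\mathbb{R}$ set $x_1\oplus x_2=t\{t^{-1}(x_1)+t^{-1}(x_2)\}$, $a\circ x_1=t\{a\,t^{-1}(x_1)\}$, and $x_1\ominus x_2=t\{t^{-1}(x_1)-t^{-1}(x_2)\}$. The noise vector. Fix $\alpha>0$. Let $\bm Z=(Z_1,\ldots,Z_q)^\top$ be a vector of independent nonnegative random variables which are regularly varying with tail index $\alpha$ and have unit scale under a common normalizing function $b(s)\to\infty$ (as $s\to\infty$): for each $j$ and each $x>0$, $\lim_{s\to\infty}s\,\mathrm{P}(Z_j>x\,b(s))=x^{-\alpha}$. Each $Z_j$ also satisfies the lower tail condition: for all $c<0$, $s\,\mathrm{P}\{Z_j\le\exp(c\,b(s))\}\to0$ as $s\to\infty$ (in particular $Z_j>0$ almost surely). The space $\mathcal{V}^q$. For $\bm a\in\mathbb{R}^q$ define the random variable $\bm a^\top\circ\bm Z=a_1\circ Z_1\oplus\cdots\oplus a_q\circ Z_q=t\big(\sum_{j=1}^q a_j t^{-1}(Z_j)\big)$, and let $\mathcal{V}^q=\{\bm a^\top\circ\bm Z:\ \bm a\in\mathbb{R}^q\}$, with random variables identified when almost surely equal. Each element of $\mathcal{V}^q$ is uniquely determined by its coefficient vector $\bm a$. For $X_1=\bm a_1^\top\circ\bm Z$, $X_2=\bm a_2^\top\circ\bm Z$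 and $c\in\mathbb{R}$, the vector space operations are $X_1\oplus X_2=(\bm a_1+\bm a_2)^\top\circ\bm Z$, $c\circ X_1=(c\,\bm a_1)^\top\circ\bm Z$, and $X_1\ominus X_2=(\bm a_1-\bm a_2)^\top\circ\bm Z$. The inner product is $\langle X_1,X_2\rangle:=\bm a_1^\top\bm a_2=\sum_{j=1}^q a_{1j}a_{2j}$, the norm is $\|X\|_{\mathcal{V}^q}=\sqrt{\langle X,X\rangle}$, and the metric is $d(X_1,X_2)=\|X_1\ominus X_2\|_{\mathcal{V}^q}=\sqrt{\sum_{j=1}^q(a_{1j}-a_{2j})^2}$. *)

(* Defs.v *)
From HB Require Import structures.
From mathcomp Require Import all_boot all_order all_algebra.
From mathcomp Require Import all_classical all_reals all_analysis.
Set Implicit Arguments.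
Unset Strict Implicit.
Unset Printing Implicit Defensive.
From mathcomp Require Import measurable_realfun.
Import Order.TTheory GRing.Theory Num.Theory.
Import numFieldNormedType.Exports.
Local Open Scope classical_set_scope.
Local Open Scope ring_scope.

Section Transform.
Variable R : realType.

Definition tfun (y : R) : R := ln (1 + expR y).

(* Meaningful on x > 0 only; [ln] is 0 on nonpositive arguments. *)
Definition tinv (x : R) : R := ln (expR x - 1).

Lemma tfunK : cancel tfun tinv.
Proof.
move=> y; rewrite /tfun /tinv lnK; first by rewrite addrC addrA addNr add0r expRK.
by rewrite posrE addr_gt0 ?expR_gt0.
Qed.

Lemma measurable_tfun : measurable_fun [set: R] tfun.
Proof.
apply: (measurableT_comp (@measurable_ln R)).
by apply: measurable_funD; [exact: measurable_cst | exact: measurable_expR].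
Qed.

Lemma measurable_tinv : measurable_fun [set: R] tinv.
Proof.
apply: (measurableT_comp (@measurable_ln R)).
by apply: measurable_funB; [exact: measurable_expR | exact: measurable_cst].
Qed.

HB.instance Definition _ := isMeasurableFun.Build _ _ _ _ tfun measurable_tfun.
HB.instance Definition _ := isMeasurableFun.Build _ _ _ _ tinv measurable_tinv.

Definition toplus (x1 x2 : R) : R := tfun (tinv x1 + tinv x2).
Definition tominus (x1 x2 : R) : R := tfun (tinv x1 - tinv x2).
Definition tscale (a x : R) : R := tfun (a * tinv x).

End Transform.

Section RandomVariables.
Context {d : measure_display} {T : measurableType d} {R : realType}.
Variable P : probability T R.

Definition oplus_fun (X Y : {RV P >-> R}) (w : T) : R := toplus (X w) (Y w).
Definition ominus_fun (X Y : {RV P >-> R}) (w : T) : R := tominus (X w) (Y w).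
Definition scale_fun (a : R) (X : {RV P >-> R}) (w : T) : R := tscale a (X w).

Lemma measurable_oplus_fun X Y : measurable_fun [set: T] (oplus_fun X Y).
Proof.
apply: (measurableT_comp (@measurable_tfun R)).
by apply: measurable_funD; apply: (measurableT_comp (@measurable_tinv R)).
Qed.

Lemma measurable_ominus_fun X Y : measurable_fun [set: T] (ominus_fun X Y).
Proof.
apply: (measurableT_comp (@measurable_tfun R)).
by apply: measurable_funB; apply: (measurableT_comp (@measurable_tinv R)).
Qed.

Lemma measurable_scale_fun a X : measurable_fun [set: T] (scale_fun a X).
Proof.
apply: (measurableT_comp (@measurable_tfun R)).
apply: measurable_funM; first exact: measurable_cst.
exact: (measurableT_comp (@measurable_tinv R)).
Qed.

HB.instance Definition _ X Y :=
  isMeasurableFun.Build _ _ _ _ (oplus_fun X Y) (measurable_oplus_fun X Y).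
HB.instance Definition _ X Y :=
  isMeasurableFun.Build _ _ _ _ (ominus_fun X Y) (measurable_ominus_fun X Y).
HB.instance Definition _ a X :=
  isMeasurableFun.Build _ _ _ _ (scale_fun a X) (measurable_scale_fun a X).

Definition oplus (X Y : {RV P >-> R}) : {RV P >-> R} := oplus_fun X Y.
Definition ominus (X Y : {RV P >-> R}) : {RV P >-> R} := ominus_fun X Y.
Definition scale (a : R) (X : {RV P >-> R}) : {RV P >-> R} := scale_fun a X.

(* t(0) = log 2 is the neutral element of the transformed addition. *)
Definition ozero : {RV P >-> R} := cst (tfun 0).

(* c_1 o X_1 (+) ... (+) c_n o X_n *)
Definition lincomb (n : nat) (c : 'cV[R]_n) (X : 'I_n -> {RV P >-> R}) :
    {RV P >-> R} :=
  \big[oplus/ozero]_(i < n) scale (c i 0) (X i).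

Lemma lincombE n (c : 'cV[R]_n) (X : 'I_n -> {RV P >-> R}) w :
  lincomb c X w = tfun (\sum_(i < n) c i 0 * tinv (X i w)).
Proof.
rewrite /lincomb; elim/big_rec2: _ => // i y Y _ IH.
by rewrite /= /oplus_fun /toplus IH /= /scale_fun /tscale !tfunK.
Qed.

Definition independent_rvs (q : nat) (Z : 'I_q -> {RV P >-> R}) : Prop :=
  forall B : 'I_q -> set R, (forall j, measurable (B j)) ->
    P (\bigcap_(j in [set: 'I_q]) (Z j @^-1` B j)) =
    (\prod_(j < q) P (Z j @^-1` B j))%E.

Record noise_vector (alpha : R) (b : R -> R) (q : nat)
    (Z : 'I_q -> {RV P >-> R}) : Prop := {
  noise_indep : independent_rvs Z;
  noise_ge0 : forall j, {ae P, forall w, 0 <= Z j w};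
  noise_norm : b s @[s --> +oo] --> +oo;
  noise_upper : forall j (x : R), 0 < x ->
    s * fine (P [set w | x * b s < Z j w]) @[s --> +oo] --> x `^ (- alpha);
  noise_lower : forall j (c : R), c < 0 ->
    s * fine (P [set w | Z j w <= expR (c * b s)]) @[s --> +oo] --> (0 : R) }.

Section Space.
Variables (q : nat) (Z : 'I_q -> {RV P >-> R}).

(* [represents a X]: X is the element of V^q with coefficient vector a; elements
   are identified when almost surely equal. *)
Definition represents (a : 'cV[R]_q) (X : {RV P >-> R}) : Prop :=
  X = lincomb a Z %[ae P].

(* The coefficient vector of an element of V^q, which is unique when Z is a noise
   vector; the value outside V^q is the dummy 0. *)
Definition coef (X : {RV P >-> R}) : 'cV[R]_q :=
  xget 0 [set a | represents a X].

Definition inner (X Y : {RV P >-> R}) : R :=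
  \sum_(j < q) coef X j 0 * coef Y j 0.

Definition normV (X : {RV P >-> R}) : R := Num.sqrt (inner X X).

Definition distV (X Y : {RV P >-> R}) : R := normV (ominus X Y).

End Space.
End RandomVariables.

Definition is_minimizer (R : realType) (V : Type) (f : V -> R) (x : V) : Prop :=
  forall y, f x <= f y.

(* Main.v *)
Require Import Defs.
From HB Require Import structures.
From mathcomp Require Import all_boot all_order all_algebra.
From mathcomp Require Import all_classical all_reals all_analysis.
From mathcomp Require Import ring.
Set Implicit Arguments.
Unset Strict Implicit.
Unset Printing Implicit Defensive.
Import Order.TTheory GRing.Theory Num.Theory.
Import numFieldNormedType.Exports.
Local Open Scope classical_set_scope.
Local Open Scope ring_scope.

(* The coefficient vector of an element of V^q is unique because no nonzero
   combination of the variables [tinv (Z j)] vanishes almost surely: they are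
   independent, and each of them is unbounded above. The distance is then a
   Euclidean distance between coefficient vectors, and the claim is the normal
   equation of the least squares problem [min_b |A^T b - alast|], obtained by
   moving [b] along the gradient [A (A^T b - alast)]. *)

(** As [tfun y] is positive, so is [x]; hence the dummy value of [ln] never enters and monotonicity
    of [ln] applies. *)
Lemma tinv_gt (R : realType) (y x : R) : tfun y < x -> y < tinv x.
Proof.
have y1 : 0 < 1 + expR y by rewrite addr_gt0 ?expR_gt0.
rewrite -ltr_expR lnK ?posrE// => yx.
have xy : expR y < expR x - 1 by rewrite ltrBrDl.
by rewrite -(expRK y) ltr_ln ?posrE ?expR_gt0// (lt_trans _ xy) ?expR_gt0.
Qed.

Lemma measurable_preimage_gt (d : measure_display) (T : measurableType d) (R : realType)
    (Y : T -> R) (M : R) :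
  measurable_fun setT Y -> measurable [set w | M < Y w].
Proof.
move=> mY; have -> : [set w | M < Y w] = setT `&` Y @^-1` `]M, +oo[.
  by apply/seteqP; split => w /=; rewrite in_itv/= andbT// => -[].
by apply: mY => //; exact: measurable_itv.
Qed.

Lemma measurable_preimage_norm_le (d : measure_display) (T : measurableType d) (R : realType)
    (Y : T -> R) (M : R) :
  measurable_fun setT Y -> measurable [set w | `|Y w| <= M].
Proof.
move=> mY; have -> : [set w | `|Y w| <= M] = setT `&` Y @^-1` `[- M, M].
  by apply/seteqP; split => w /=; rewrite in_itv/= ler_norml// => -[].
by apply: mY => //; exact: measurable_itv.
Qed.

(** * Uniqueness and arithmetic of coefficient vectors *)

Section Coefficients.
Context {d : measure_display} {T : measurableType d} {R : realType}.
Variable P : probability T R.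

(** The events for integer [M] exhaust the space, so they cannot all be null. *)
Lemma prob_bounded_gt0 (Y : T -> R) : measurable_fun setT Y ->
  exists M : R, (0 < P [set w | `|Y w| <= M]%R)%E.
Proof.
move=> mY; apply: contrapT => /forallNP noM.
have : P setT = 0%E.
  apply: measure_negligible => //.
  have -> : setT = \bigcup_n [set w | `|Y w| <= n%:R].
    rewrite eqEsubset; split=> // w _.
    exists (Num.bound (`|Y w|)) => //=.
    by apply: ltW; exact: archi_boundP.
  apply: negligible_bigcup => n; apply/negligibleP.
    exact: measurable_preimage_norm_le.
  by apply/eqP; rewrite eq_le measure_ge0 andbT leNgt; apply/negP/noM.
by rewrite probability_setT => /eqP; rewrite onee_eq0.
Qed.

(** At [x = 1] the upper tail limit is 1, so for large [s] the event [nrm s < Z k] has positive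
    probability, while [nrm s] already exceeds [M]. *)
Lemma noise_tail_gt0 (alpha : R) (nrm : R -> R) (q : nat)
    (Z : 'I_q -> {RV P >-> R}) (hZ : noise_vector alpha nrm Z) (k : 'I_q) (M : R) :
  (0 < P [set w | M < Z k w]%R)%E.
Proof.
have [_ _ nrmy /(_ k 1 ltr01) up _] := hZ.
rewrite powR1 in up.
have [s [Ms tl]] : exists s : R, M < nrm s /\
    0 < s * fine (P [set w | 1 * nrm s < Z k w]).
  near (pinfty_nbhs R) => s; exists s; split; near: s; first exact: (cvgry_gt nrmy).
  exact: (cvgr_gt _ up).
have : (0 < P [set w | (1 * nrm s < Z k w)%R])%E.
  rewrite lt_neqAle measure_ge0 andbT; apply/eqP => P0.
  by move: tl; rewrite -P0 /= mulr0 ltxx.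
move=> /lt_le_trans; apply; apply: le_measure; rewrite ?inE;
  [exact: measurable_preimage_gt..|].
by move=> w /=; rewrite mul1r; exact: lt_trans.
Unshelve. all: by end_near. Qed.

(* If [c k != 0], by independence all the [tinv (Z j)] with [j != k] are bounded
   while [tinv (Z k)] is arbitrarily large with positive probability, so that
   [c k * tinv (Z k)] cannot be cancelled by the other terms. *)
Lemma noise_free (alpha : R) (nrm : R -> R) (q : nat)
    (Z : 'I_q -> {RV P >-> R}) (hZ : noise_vector alpha nrm Z) (c : 'I_q -> R) :
  {ae P, forall w, \sum_j c j * tinv (Z j w) = 0} -> forall k, c k = 0.
Proof.
move=> c0 k; apply/eqP/negP => /negP ck0.
have mt j : measurable_fun setT (@tinv R \o Z j).
  exact: (measurableT_comp (@measurable_tinv R)).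
have /choice[M PM] j := prob_bounded_gt0 (mt j).
(* [S] bounds the terms with [j != k], and [K] is the level of [tinv (Z k)] beyond which the [k]-th
   term exceeds [S] in absolute value. *)
pose S := \sum_(j | j != k) `|c j| * M j.
pose K := S / `|c k|.
pose B j : set R := if j == k then [set x | tfun K < x] else [set x | `|tinv x| <= M j].
have mB j : measurable (B j).
  rewrite /B; case: ifP => _; first exact: (@measurable_preimage_gt _ _ R id).
  exact: measurable_preimage_norm_le (@measurable_tinv R).
have PB j : (0 < P (Z j @^-1` B j))%E.
  rewrite /B; case: ifP => _; last exact: PM.
  exact: noise_tail_gt0 hZ _ _.
have : (0 < P (\bigcap_(j in [set: 'I_q]) (Z j @^-1` B j)))%E.
  rewrite (noise_indep hZ)//; apply: (big_ind (fun x => 0 < x)%E) => //.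
  by move=> x y; exact: mule_gt0.
rewrite ltNge => /negP; apply.
have mI : measurable (\bigcap_(j in [set: 'I_q]) (Z j @^-1` B j)).
  apply: fin_bigcap_measurable => [|j _]; first exact: finite_finset.
  by rewrite -[X in measurable X]setTI; exact: measurable_funP.
rewrite le_eqVlt; apply/orP; left; apply/eqP; apply: measure_negligible => //.
(* It remains to place the event inside the exceptional null set: no [w] in it makes the combination
   vanish. *)
apply: negligibleS c0 => w /= wB wS.
have wk : K < tinv (Z k w).
  by have := wB k I; rewrite /B /= eqxx => /tinv_gt.
have wj j : j != k -> `|tinv (Z j w)| <= M j.
  by move=> /negbTE jk; have := wB j I; rewrite /B /= jk.
have ck : 0 < `|c k| by rewrite normr_gt0.
have SE : c k * tinv (Z k w) = - \sum_(j | j != k) c j * tinv (Z j w).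
  by move/eqP: wS; rewrite (bigD1 k)//= addr_eq0 => /eqP.
have : `|c k * tinv (Z k w)| <= S.
  rewrite SE normrN (le_trans (ler_norm_sum _ _ _))// ler_sum// => j jk.
  by rewrite normrM ler_wpM2l// wj.
rewrite normrM leNgt => /negP; apply.
by rewrite -ltr_pdivrMl// mulrC (lt_le_trans wk)// ler_norm.
Qed.

(** Injectivity of [tfun] turns two representations into an almost surely vanishing combination with
    coefficients [a - a']. *)
Lemma represents_inj (alpha : R) (nrm : R -> R) (q : nat)
    (Z : 'I_q -> {RV P >-> R}) (hZ : noise_vector alpha nrm Z)
    (a a' : 'cV[R]_q) (X : {RV P >-> R}) :
  represents Z a X -> represents Z a' X -> a = a'.
Proof.
move=> Xa Xa'; apply/colP => k; apply/eqP; rewrite -subr_eq0; apply/eqP.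
move: k; apply: (noise_free hZ); move: Xa Xa'; apply: filterS2 => w /(_ I) e /(_ I).
rewrite e !lincombE => /(can_inj (@tfunK R)) /eqP.
rewrite -subr_eq0 -sumrB => /eqP e0; rewrite -[RHS]e0.
by apply: eq_bigr => j _; rewrite mulrBl.
Qed.

Lemma coefE (alpha : R) (nrm : R -> R) (q : nat)
    (Z : 'I_q -> {RV P >-> R}) (hZ : noise_vector alpha nrm Z)
    (a : 'cV[R]_q) (X : {RV P >-> R}) :
  represents Z a X -> coef Z X = a.
Proof. by move=> Xa; apply: xget_unique => // a' Xa'; exact: (represents_inj hZ Xa' Xa). Qed.

Lemma represents_lincomb (q n : nat) (Z : 'I_q -> {RV P >-> R})
    (A : 'M[R]_(n, q)) (X : 'I_n -> {RV P >-> R}) (b : 'cV[R]_n) :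
  (forall i, represents Z (\col_j A i j) (X i)) ->
  represents Z (A^T *m b) (lincomb b X).
Proof.
move=> XA.
(* Finitely many almost sure identities hold together off a single null set. *)
have : \forall w \near almost_everywhere P, forall i,
    setT w -> X i w = lincomb (\col_j A i j) Z w by exact: filter_forall.
apply: filterS => w {}XA _.
rewrite !lincombE; congr tfun.
under eq_bigr => i _ do rewrite (XA i I) lincombE tfunK mulr_sumr.
rewrite exchange_big; apply: eq_bigr => j _ /=.
rewrite mxE mulr_suml; apply: eq_bigr => i _.
by rewrite !mxE mulrA (mulrC (b i 0)).
Qed.

Lemma represents_ominus (q : nat) (Z : 'I_q -> {RV P >-> R})
    (a a' : 'cV[R]_q) (X X' : {RV P >-> R}) :
  represents Z a X -> represents Z a' X' -> represents Z (a - a') (ominus X X').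
Proof.
apply: filterS2 => w /(_ I) e /(_ I) e' _.
rewrite /ominus /= /ominus_fun /tominus e e' !lincombE !tfunK -sumrB.
by congr tfun; apply: eq_bigr => j _; rewrite !mxE mulrBl.
Qed.

End Coefficients.

(** * Euclidean least squares and the normal equation *)

Section LeastSquares.
Variable R : realFieldType.

Definition dotv n (u v : 'cV[R]_n) : R := \sum_j u j 0 * v j 0.

Lemma dotvC n (u v : 'cV[R]_n) : dotv u v = dotv v u.
Proof. by apply: eq_bigr => j _; rewrite mulrC. Qed.

Lemma dotvv_ge0 n (u : 'cV[R]_n) : 0 <= dotv u u.
Proof. by apply: sumr_ge0 => j _; rewrite -expr2 sqr_ge0. Qed.

Lemma dotvv_eq0 n (u : 'cV[R]_n) : dotv u u = 0 -> u = 0.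
Proof.
move=> /eqP; rewrite psumr_eq0 => [/allP u0|j _]; last by rewrite -expr2 sqr_ge0.
apply/colP => j; rewrite mxE; apply/eqP.
by have := u0 j (mem_index_enum j); rewrite mulf_eq0 orbb.
Qed.

Lemma dotv_trmul m n (A : 'M[R]_(m, n)) (u : 'cV[R]_m) (v : 'cV[R]_n) :
  dotv (A^T *m u) v = dotv u (A *m v).
Proof.
rewrite /dotv.
under eq_bigr => j _ do rewrite mxE mulr_suml.
rewrite exchange_big; apply: eq_bigr => i _ /=; rewrite mxE mulr_sumr.
by apply: eq_bigr => j _; rewrite mxE mulrCA mulrA.
Qed.

Lemma dotv_sqrD n (u v : 'cV[R]_n) (t : R) :
  dotv (u + t *: v) (u + t *: v) = dotv u u + 2 * t * dotv u v + t ^+ 2 * dotv v v.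
Proof.
rewrite /dotv !mulr_sumr -!big_split; apply: eq_bigr => j _ /=.
by rewrite !mxE; ring.
Qed.

Lemma normal_equation_of_minimizer m n (A : 'M[R]_(m, n)) (l : 'cV[R]_n) (b : 'cV[R]_m) :
  (forall b', dotv (A^T *m b - l) (A^T *m b - l) <=
              dotv (A^T *m b' - l) (A^T *m b' - l)) ->
  (A *m A^T) *m b = A *m l.
Proof.
(* [r] is the residual and [g] half the gradient of the objective at [b]; the normal equation says
   [g = 0]. *)
move=> bmin; pose r := A^T *m b - l; pose g := A *m r.
suff /dotvv_eq0/eqP : dotv g g = 0.
  by rewrite /g /r mulmxBr subr_eq0 mulmxA => /eqP.
pose G := dotv g g; pose H := dotv (A^T *m g) (A^T *m g).
have G0 : 0 <= G := dotvv_ge0 _.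
have H0 : 0 <= H := dotvv_ge0 _.
have H1 : 0 < 1 + H by rewrite ltr_wpDr.
(* The right-hand side is the change of the objective when [b] moves to [b - t *: g]. *)
have quad t : 0 <= t * (t * H - 2 * G).
  have := bmin (b - t *: g).
  rewrite mulmxBr -scalemxAr addrAC -/r -scaleNr dotv_sqrD.
  rewrite (dotvC r) dotv_trmul -/g -/G -/H.
  by rewrite -subr_ge0; congr (0 <= _); ring.
(* This step decreases the objective unless [G = 0]; the usual [G / H] would need [H != 0]. *)
have := quad (G / (1 + H)).
have -> : G / (1 + H) * (G / (1 + H) * H - 2 * G) = - ((G / (1 + H)) ^+ 2 * (2 + H)).
  by field; rewrite gt_eqF.
rewrite oppr_ge0 pmulr_lle0; last by rewrite ltr_wpDr.
by rewrite real_exprn_even_le0 ?num_real//= mulf_eq0 invr_eq0 (gt_eqF H1) orbF => /eqP.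
Qed.

(** Pythagoras: the normal equation makes the residual orthogonal to the range of [A^T], so the
    cross term vanishes and any move adds a square. *)
Lemma minimizer_of_normal_equation m n (A : 'M[R]_(m, n)) (l : 'cV[R]_n) (b : 'cV[R]_m) :
  (A *m A^T) *m b = A *m l ->
  forall b', dotv (A^T *m b - l) (A^T *m b - l) <=
             dotv (A^T *m b' - l) (A^T *m b' - l).
Proof.
move=> ne b'; set r := A^T *m b - l.
(* The factor 1 gives the shape expected by [dotv_sqrD]. *)
have -> : A^T *m b' - l = r + 1 *: (A^T *m (b' - b)).
  by rewrite scale1r mulmxBr /r addrC [RHS]addrC addrA subrK addrC.
rewrite dotv_sqrD (dotvC r) dotv_trmul.
have -> : A *m r = 0 by rewrite mulmxBr mulmxA ne subrr.
have -> : dotv (b' - b) 0 = 0 by apply: big1 => j _; rewrite [X in _ * X]mxE mulr0.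
by rewrite mulr0 addr0 lerDl mulr_ge0 ?sqr_ge0 ?dotvv_ge0.
Qed.

End LeastSquares.

Theorem mainTheorem2 (R : realType) (d : measure_display) (T : measurableType d)
    (P : probability T R) (p q : nat) (hp : (0 < p)%N) (hq : (0 < q)%N)
    (alpha : R) (halpha : 0 < alpha) (nrm : R -> R)
    (Z : 'I_q -> {RV P >-> R}) (hZ : noise_vector alpha nrm Z)
    (a : 'I_p.+1 -> 'cV[R]_q) (X : 'I_p.+1 -> {RV P >-> R})
    (hX : forall i, represents Z (a i) (X i)) :
  let Xp : 'I_p -> {RV P >-> R} := fun i => X (widen_ord (leqnSn p) i) in
  let Xlast : {RV P >-> R} := X ord_max in
  let A : 'M[R]_(p, q) := \matrix_(i, j) a (widen_ord (leqnSn p) i) j 0 in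
  let alast : 'cV[R]_q := a ord_max in
  let Gamma11 : 'M[R]_p := \matrix_(i, j) inner Z (Xp i) (Xp j) in
  let Gamma12 : 'cV[R]_p := \col_i inner Z (Xp i) Xlast in
  let dist : 'cV[R]_p -> R := fun b => distV Z (lincomb b Xp) Xlast in
  [/\ Gamma11 = A *m A^T,
      Gamma12 = A *m alast,
      forall b : 'cV[R]_p, is_minimizer dist b -> (A *m A^T) *m b = A *m alast &
      A *m A^T \in unitmx ->
        (forall b : 'cV[R]_p,
           is_minimizer dist b <-> b = invmx (A *m A^T) *m (A *m alast)) /\
        invmx (A *m A^T) *m (A *m alast) = invmx Gamma11 *m Gamma12].
Proof.
move=> Xp Xlast A alast Gamma11 Gamma12 dist.
have cX i : coef Z (X i) = a i by exact: (coefE hZ).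
have G11 : Gamma11 = A *m A^T.
  apply/matrixP => i j; rewrite !mxE /inner !cX.
  by apply: eq_bigr => k _; rewrite !mxE.
have G12 : Gamma12 = A *m alast.
  apply/colP => i; rewrite !mxE /inner !cX.
  by apply: eq_bigr => k _; rewrite !mxE.
have distE b : dist b = Num.sqrt (dotv (A^T *m b - alast) (A^T *m b - alast)).
  rewrite /dist /distV /normV /inner (coefE hZ (a := A^T *m b - alast))//.
  apply: represents_ominus; last exact: hX.
  apply: represents_lincomb => i.
  have -> : \col_j A i j = a (widen_ord (leqnSn p) i) by apply/colP => j; rewrite !mxE.
  exact: hX.
(* The square root preserves order on nonnegative reals, so minimizing [dist] amounts to minimizing
   the squared distance. The converse direction shows that the closed formula does attain the
   minimum. *)
have minE b : is_minimizer dist b <-> (A *m A^T) *m b = A *m alast.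
  split=> [bmin|ne b'].
    apply: normal_equation_of_minimizer => b'.
    by rewrite -ler_sqrt ?dotvv_ge0// -!distE.
  by rewrite !distE ler_sqrt ?dotvv_ge0//; exact: minimizer_of_normal_equation.
split=> // [b /minE //|Au]; split; last by rewrite G11 G12.
move=> b; split=> [/minE <-|->]; first by rewrite mulKmx.
by apply/minE; rewrite mulKVmx.
Qed.
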